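(* Let $n\ge4$ and let $\mathcal{T}=(V,E)$ be a 4-uniform hypergraph with $|V|=n$ and $|E|=n-3$. Then $$\min_{v_1,v_2,v_3}P\bigl(G_{\mathcal{T}}-\{v_1,v_2,v_3\}\bigr)\neq0\quad\text{if and only if}\quad\sigma(G_{\mathcal{T}})=3,$$ where the minimum is over all triples of distinct vertices $v_1,v_2,v_3\in V$.
   Context: A 4-uniform hypergraph $\mathcal{T}=(V,E)$ consists of a finite vertex set $V$ and a finite family $E$ of hyperedges, each a 4-element subset of $V$; repeated hyperedges are allowed (i.e. $E$ is an indexed family). Its incidence graph $G_{\mathcal{T}}$ is the bipartite graph with vertex set $V\sqcup E$ and edge set $I=\{(v,e)\in V\times E:v\in e\}$. The graph $G_{\mathcal{T}}-\{v_1,v_2,v_3\}$ is obtained by deleting the vertices $v_1,v_2,v_3$. A perfect matching in a bipartite graph $G=(A\sqcup B,I)$ is a bijection $f:A\to B$ with $(a,f(a))\in I$ for all $a\in A$, and $P(G)$ is the number of perfect matchings in $G$. Surplus: for a nonempty set $E'\subseteq E$, let $\mathcal{N}(E')=\{v\in V: v\in e\text{ for some }e\in E'\}$ be its neighborhood in $G_{\mathcal{T}}$. The surplus of $G_{\mathcal{T}}$ (with respect to $E$) is $$\sigma(G_{\mathcal{T}})=\min_{\emptyset\neq E'\subseteq E}\bigl(|\mathcal{N}(E')|-|E'|\bigr).$$ *)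

(* Defs.v *)
From mathcomp Require Import all_boot all_order all_algebra.
Import Order.TTheory GRing.Theory Num.Theory.

Set Implicit Arguments.
Unset Strict Implicit.
Unset Printing Implicit Defensive.

(* Minimum of [F i] over the [i] satisfying [P]; the value [x0] is only
   returned when no [i] satisfies [P] (see [min_overP]). *)
Definition min_over (d : Order.disp_t) (T : orderType d) (I : finType)
    (x0 : T) (P : pred I) (F : I -> T) : T :=
  if [pick i | P i] is Some i0 then F [arg min_(i < i0 | P i) F i]%O else x0.

Lemma min_overP (d : Order.disp_t) (T : orderType d) (I : finType)
    (x0 : T) (P : pred I) (F : I -> T) :
  (exists i, P i) ->
  (exists2 i, P i & min_over x0 P F = F i) /\
  (forall i, P i -> (min_over x0 P F <= F i)%O).
Proof.
rewrite /min_over => -[j Pj]; case: pickP => [i0 Pi0 | /(_ j)]; last by rewrite Pj.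
by case: Order.TotalTheory.arg_minP => // i Pi le_i; split=> //; exists i.
Qed.

(* A bipartite graph with sides [A] and [B] is given by its edge set
   [G : {set A * B}]. *)
Section BipartiteGraphs.

Variables A B : finType.
Implicit Types (G : {set A * B}) (S : {set A}) (X : {set B}).

Definition is_perfect_matching G (f : {ffun A -> B}) : bool :=
  [&& injectiveb f, [forall b, b \in codom f] & [forall a, (a, f a) \in G]].

Definition num_perfect_matchings G : nat :=
  #|[set f | is_perfect_matching G f]|.

Definition delete_left G S : {set {a : A | a \notin S} * B} :=
  [set p | (val p.1, p.2) \in G].

Definition neighborhood G X : {set A} :=
  [set a | [exists b in X, (a, b) \in G]].

(* Surplus with respect to [B]; meaningful for [B] nonempty. *)
Definition surplus G : int :=
  min_over 0%R (fun X : {set B} => X != set0)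
    (fun X : {set B} => #|neighborhood G X|%:Z - #|X|%:Z)%R.

End BipartiteGraphs.

Lemma is_perfect_matchingP (A B : finType) (G : {set A * B})
    (f : {ffun A -> B}) :
  reflect (bijective f /\ forall a, (a, f a) \in G) (is_perfect_matching G f).
Proof.
apply: (iffP and3P) => [[/injectiveP injf /forallP surjf /forallP fG] | [bijf fG]].
  split=> //; exists (fun b => iinv (surjf b)) => [a | b]; last exact: f_iinv.
  exact/injf/f_iinv.
split; [exact/injectiveP/bij_inj | | exact/forallP].
by apply/forallP=> b; case: bijf => g _ gK; rewrite -(gK b) codom_f.
Qed.

(* A hypergraph is an indexed family of hyperedges [T : E -> {set V}], so that
   hyperedges may be repeated. *)
Definition uniform (k : nat) (V E : finType) (T : E -> {set V}) : Prop :=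
  forall e, #|T e| = k.

Definition incidence_graph (V E : finType) (T : E -> {set V}) : {set V * E} :=
  [set p | p.1 \in T p.2].

Definition min_matchings_minus3 (V E : finType) (G : {set V * E}) : nat :=
  min_over 0%N
    (fun t : V * V * V => let: (v1, v2, v3) := t in uniq [:: v1; v2; v3])
    (fun t : V * V * V => let: (v1, v2, v3) := t in
       num_perfect_matchings (delete_left G [set v1; v2; v3])).

(* Main.v *)
Require Import Defs.
From mathcomp Require Import all_boot all_order all_algebra.
From mathcomp Require Import zify.

(** Deleting a set [S] of three vertices leaves sides of equal size [n - 3], so
    by Hall's theorem a perfect matching survives exactly when
    [#|X| <= #|N(X) :\: S|] for every set [X] of hyperedges.  If the surplus
    is 3, then [N(X) :\: S] has at least [#|N(X)| - 3 >= #|X|] elements for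
    nonempty [X], whatever [S] is.  Conversely, a nonempty [X] has
    [#|N(X)| >= 4] because hyperedges have four vertices, so [S] can be chosen
    inside [N(X)]; Hall's condition for this [S] then reads
    [#|X| <= #|N(X)| - 3].  This equivalence is [hall_deletedP].  Finally the
    surplus never exceeds 3, as the choice of all hyperedges for [X] shows, so
    that a surplus of at least 3 is a surplus equal to 3 ([surplus_eqP]).

    Hall's theorem ([hall_marriage]) is proved by Rado's argument: edges are
    removed for as long as Hall's condition survives.  Submodularity of
    [X |-> #|N(X)|] shows that if a vertex has two neighbours, one of these two
    edges can be removed ([hall_delete_edge]); when no such vertex is left, the
    graph is itself the wanted matching. *)

Set Implicit Arguments.
Unset Strict Implicit.

Section Hall.

Context {A B : finType}.
Implicit Types (G : {set A * B}) (X Y : {set B}) (S : {set A}).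

Lemma neighborhoodP G X a :
  reflect (exists2 b, b \in X & (a, b) \in G) (a \in neighborhood G X).
Proof. by rewrite inE; apply: exists_inP. Qed.

Lemma neighborhoodS G X Y :
  X \subset Y -> neighborhood G X \subset neighborhood G Y.
Proof.
move=> /subsetP sXY; apply/subsetP => a /neighborhoodP[b bX abG].
by apply/neighborhoodP; exists b; rewrite ?sXY.
Qed.

Definition hall_condition G : bool :=
  [forall X : {set B}, #|X| <= #|neighborhood G X|].

Lemma neighborhood_setD1_notin G X a b :
  b \notin X -> neighborhood (G :\ (a, b)) X = neighborhood G X.
Proof.
move=> bX; apply/setP => c; apply/neighborhoodP/neighborhoodP => -[d dX].
  by rewrite !inE => /andP[_ cdG]; exists d.
move=> cdG; exists d; rewrite // !inE cdG andbT.
by apply: contraNneq bX => -[_ <-].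
Qed.

(** Sets [X] and [Y] violating Hall's condition after the removal of [(x, b)],
    respectively [(y, b)], both contain [b], as the neighbourhood of a set
    without [b] does not change.  Their neighbourhoods in the two
    smaller graphs jointly cover the neighbourhood of [X :|: Y] in [G], since
    each graph retains the edge that the other one lost, and both contain that
    of [X :&: Y] minus [b].  Adding cardinals contradicts Hall's condition
    for [G]. *)
Lemma hall_delete_edge G x y b :
  hall_condition G -> x != y ->
  hall_condition (G :\ (x, b)) || hall_condition (G :\ (y, b)).
Proof.
move=> /forallP hallG xy; apply: contraT; rewrite negb_or !negb_forall.
case/andP => /existsP[X]; rewrite -ltnNge => ltX.
case/existsP => Y; rewrite -ltnNge => ltY.
have bX : b \in X.
  by apply: contraTT ltX => /neighborhood_setD1_notin ->; rewrite -leqNgt.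
have bY : b \in Y.
  by apply: contraTT ltY => /neighborhood_setD1_notin ->; rewrite -leqNgt.
set NX := neighborhood _ X in ltX; set NY := neighborhood _ Y in ltY.
have sU : neighborhood G (X :|: Y) \subset NX :|: NY.
  apply/subsetP => a /neighborhoodP[c cXY acG]; rewrite inE.
  have [cb | cb] := eqVneq c b.
    subst c; have [ax | ax] := eqVneq a x.
      apply/orP; right; apply/neighborhoodP; exists b => //.
      by rewrite !inE acG ax xpair_eqE (negPf xy).
    apply/orP; left; apply/neighborhoodP; exists b => //.
    by rewrite !inE acG xpair_eqE (negPf ax).
  by move: cXY; rewrite inE => /orP[cX | cY]; apply/orP; [left | right];
    apply/neighborhoodP; exists c; rewrite // !inE acG xpair_eqE (negPf cb) andbF.
have sI : neighborhood G ((X :&: Y) :\ b) \subset NX :&: NY.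
  have bI : b \notin (X :&: Y) :\ b by rewrite !inE eqxx.
  rewrite subsetI -{1}(neighborhood_setD1_notin G x bI).
  rewrite -(neighborhood_setD1_notin G y bI).
  by rewrite !neighborhoodS // (subset_trans (subD1set _ _)) // (subsetIl, subsetIr).
have := leq_trans (hallG _) (subset_leq_card sU).
have := leq_trans (hallG _) (subset_leq_card sI).
have := cardsD1 b (X :&: Y); rewrite inE bX bY /=.
have := cardsUI X Y; have := cardsUI NX NY; lia.
Qed.

(** An edge-minimal graph satisfying Hall's condition gives every vertex of [B]
    exactly one neighbour: at least one by Hall's condition for a singleton, at
    most one by [hall_delete_edge].  The induction on the number of edges
    reaches such a graph. *)
Theorem hall_marriage G :
  hall_condition G ->
  exists2 f : B -> A, injective f & forall b, (f b, b) \in G.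
Proof.
have [k] := ubnP #|G|; elim: k G => // k IHk G ltG hallG.
have [/existsP[[x b]] | ] := boolP [exists p in G, hall_condition (G :\ p)].
  case/andP => xbG hallGx; have [|f injf fG] := IHk _ _ hallGx.
    by move: ltG; rewrite (cardsD1 (x, b)) xbG.
  by exists f => // c; have := fG c; rewrite inE => /andP[].
move=> /exists_inPn minG.
have uniqG x y b : (x, b) \in G -> (y, b) \in G -> x = y.
  move=> /minG/negPf nx /minG/negPf ny; apply/eqP; apply: contraT => xy.
  by have := hall_delete_edge b hallG xy; rewrite nx ny.
have exG b : exists a, (a, b) \in G.
  have := forallP hallG [set b]; rewrite cards1 => /card_gt0P[a].
  by case/neighborhoodP => c /set1P -> abG; exists a.
have [f fG] := fin_all_exists exG; exists f => // b c fbc.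
(* Distinct vertices sharing their unique neighbour would form a pair with a
   single neighbour. *)
have := forallP hallG [set b; c]; rewrite cards2.
have /subset_leq_card : neighborhood G [set b; c] \subset [set f b].
  apply/subsetP => a /neighborhoodP[d /set2P[]->] adG; rewrite inE.
    by apply/eqP/(uniqG _ _ b).
  by rewrite fbc; apply/eqP/(uniqG _ _ c).
by rewrite cards1; case: eqP => //= _ le1 /leq_trans/(_ le1).
Qed.

(** A matching of the right side into a left side of the same size is
    bijective, and perfect matchings are the inverses of such matchings. *)
Lemma num_perfect_matchings_neq0 G :
  #|A| = #|B| -> (num_perfect_matchings G != 0) = hall_condition G.
Proof.
move=> eqAB; rewrite -lt0n; apply/card_gt0P/idP => [[f] | /hall_marriage].
  rewrite inE => /is_perfect_matchingP[[g fK gK] fG].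
  apply/forallP => X; rewrite -(card_imset _ (can_inj gK)).
  apply/subset_leq_card/subsetP => _ /imsetP[b bX ->].
  by apply/neighborhoodP; exists b; rewrite // -{2}(gK b).
case=> g injg gG; have [f gK fK] := inj_card_bij injg (eq_leq eqAB).
exists (finfun f); rewrite inE; apply/is_perfect_matchingP; split=> [|a].
  by exists g => [a | b]; rewrite ffunE.
by rewrite ffunE -{1}(fK a).
Qed.

End Hall.

Section DeletedVertices.

Context {A B : finType}.
Implicit Types (G : {set A * B}) (X : {set B}) (S : {set A}).

Lemma card_neighborhood_delete_left G S X :
  #|neighborhood (delete_left G S) X| = #|neighborhood G X :\: S|.
Proof.
rewrite -(card_imset _ val_inj); apply: eq_card => a; rewrite inE.
apply/imsetP/andP => [[a' /neighborhoodP[b bX]] | [aS /neighborhoodP[b bX abG]]].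
  rewrite inE => abG ->; split; first exact: (svalP a').
  by apply/neighborhoodP; exists b.
exists (exist _ a aS) => //.
by apply/neighborhoodP; exists b; rewrite // inE.
Qed.

Lemma num_perfect_matchings_delete_left G S :
  #|A| = #|B| + #|S| ->
  (num_perfect_matchings (delete_left G S) != 0)
    = [forall X : {set B}, #|X| <= #|neighborhood G X :\: S|].
Proof.
move=> cardA; rewrite num_perfect_matchings_neq0.
  by apply: eq_forallb => X; rewrite card_neighborhood_delete_left.
by rewrite card_sig; have := cardC S; rewrite cardA addnC => /addIn <-; apply: eq_card.
Qed.

(** The bound on singletons serves to find [S] of size [k] inside the
    neighbourhood of a given nonempty [X], the worst case for [X]. *)
Lemma hall_deletedP G k :
  (forall b, k <= #|neighborhood G [set b]|) ->
  (forall S, #|S| = k -> forall X, #|X| <= #|neighborhood G X :\: S|)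
  <-> (forall X, X != set0 -> #|X| + k <= #|neighborhood G X|).
Proof.
move=> degG; split=> [hallS X /set0Pn[b bX] | surplusG S cardS X].
  have : k <= #|neighborhood G X|.
    by rewrite (leq_trans (degG b)) ?subset_leq_card ?neighborhoodS ?sub1set.
  case/card_geqP=> s [uniq_s size_s /subsetP sN].
  have cardS : #|[set v in s]| = k by rewrite cardsE (card_uniqP uniq_s).
  have sS : [set v in s] \subset neighborhood G X.
    by apply/subsetP => v; rewrite inE => /(subsetP sN).
  by have := hallS _ cardS X; have := cardsDS sS; have := subset_leq_card sS; lia.
have [-> | /surplusG] := eqVneq X set0; first by rewrite cards0.
by rewrite -cardS => leX; rewrite cardsD leq_subRL;
  have := subset_leq_card (subsetIr (neighborhood G X) S); lia.
Qed.

(** The lower bound alone characterizes the equality, because [X := setT]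
    bounds the surplus above by [#|A| - #|B| = k]. *)
Lemma surplus_eqP G k :
  0 < #|B| -> #|A| = #|B| + k ->
  surplus G = k%:Z%R
  <-> (forall X, X != set0 -> #|X| + k <= #|neighborhood G X|).
Proof.
move=> B0 cardA; have TB : [set: B] != set0 by rewrite -card_gt0 cardsT.
have exX : exists X : {set B}, X != set0 by exists setT.
have [[X X0 surX] lesur] := min_overP 0%R
  (fun X => #|neighborhood G X|%:Z - #|X|%:Z)%R exX.
split=> [surG Y /lesur | surG]; first by rewrite -/(surplus G) surG; lia.
have := lesur _ TB; have := surG _ X0.
have := subset_leq_card (subsetT (neighborhood G setT)).
by rewrite -/(surplus G) in surX *; rewrite !cardsT; lia.
Qed.

(** A minimum of natural numbers is nonzero when all of them are.  Having three
    elements in [A] ensures that the minimum is attained at some triple, instead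
    of being the default value 0. *)
Lemma min_matchings_minus3_neq0 G :
  3 <= #|A| ->
  min_matchings_minus3 G <> 0
  <-> (forall S, #|S| = 3 -> num_perfect_matchings (delete_left G S) != 0).
Proof.
case/card_gt2P => x [y [z [_ [xy yz zx]]]].
pose distinct (t : A * A * A) := let: (v1, v2, v3) := t in uniq [:: v1; v2; v3].
pose num (t : A * A * A) := let: (v1, v2, v3) := t in
  num_perfect_matchings (delete_left G [set v1; v2; v3]).
have ex_distinct : exists t, distinct t.
  by exists (x, y, z); rewrite /= !inE negb_or xy yz eq_sym zx.
have [[[[a b] c] abc minG] lemin] := min_overP 0 num ex_distinct.
rewrite -[min_over _ _ _]/(min_matchings_minus3 G) in minG lemin.
split=> [/eqP min0 S cardS | numS]; last first.
  rewrite minG; apply/eqP/numS.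
  have -> : [set a; b; c] = [set v in [:: a; b; c]].
    by apply/setP => v; rewrite !inE orbA.
  by rewrite cardsE (card_uniqP abc).
have := enum_uniq S; have := set_enum S; move: cardS; rewrite cardE.
case: (enum S) => [|u [|v [|w []]]] // _ <- uvw.
have -> : [set t in [:: u; v; w]] = [set u; v; w].
  by apply/setP => t; rewrite !inE orbA.
by move: min0; rewrite -!lt0n => /leq_trans; apply; apply: (lemin (u, v, w)).
Qed.

End DeletedVertices.

Theorem proposition4p1 (n : nat) (V E : finType) (T : E -> {set V}) :
  4 <= n -> uniform 4 T -> #|V| = n -> #|E| = n - 3 ->
  (min_matchings_minus3 (incidence_graph T) <> 0
   <-> surplus (incidence_graph T) = 3%:Z%R).
Proof.
move=> n4 T4 cardV cardE; set G := incidence_graph T.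
have cardVE : #|V| = #|E| + 3 by lia.
have degG e : 3 <= #|neighborhood G [set e]|.
  rewrite -[3]/(4.-1) -(T4 e) (leq_trans (leq_pred _)) // subset_leq_card //.
  by apply/subsetP => v ve; apply/neighborhoodP; exists e; rewrite inE ?eqxx.
rewrite surplus_eqP ?cardVE //; last by lia.
rewrite min_matchings_minus3_neq0; last by lia.
rewrite -hall_deletedP //.
by split=> H S cardS; move: (H S cardS);
  rewrite num_perfect_matchings_delete_left ?cardS // => /forallP.
Qed.
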